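(* Let $p$ be a prime and let $G$ be a finite $p$-group with $|G'|=p$ and $|G:Z(G)|=p^{2n}$. Then $$P_2(G)=\frac{1}{p}+\left(1-\frac{1}{p}\right)p^{-2n},\qquad P_3(G)=\frac{p^{2n}+p^3-1}{p^{2n+3}}.$$ Equivalently (for the second formula), $$\kappa_2(G)=|G|^2P_3(G)=|G|^2\,\frac{p^{2n}+p^3-1}{p^{2n+3}}.$$
   Context: For a finite group $G$ and $r\ge 1$, $\mathrm{Comm}_r(G):=\{(x_1,\dots,x_r)\in G^r : x_ix_j=x_jx_i\ \text{for all } i,j\}$ and $P_r(G):=|\mathrm{Comm}_r(G)|/|G|^r$. $\kappa_r(G)$ is the number of orbits of $G$ acting on $\mathrm{Comm}_r(G)$ by simultaneous (diagonal) conjugation. $G'$ is the commutator subgroup and $Z(G)$ the center. For a finite $p$-group with $|G'|=p$, the index $|G:Z(G)|$ is always of the form $p^{2n}$ with $n\ge1$. *)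

(* Defs.v *)
From mathcomp Require Import all_boot all_order all_algebra.
From mathcomp Require Import all_fingroup all_solvable.

Set Implicit Arguments.
Unset Strict Implicit.
Unset Printing Implicit Defensive.

Definition Comm (gT : finGroupType) (r : nat) (G : {set gT}) :
    {set r.-tuple gT} :=
  [set x : r.-tuple gT |
     [forall i, tnth x i \in G] &&
     [forall i, forall j,
        (tnth x i * tnth x j)%g == (tnth x j * tnth x i)%g]].

Definition P (gT : finGroupType) (r : nat) (G : {set gT}) : rat :=
  (#|Comm r G|%:R / #|G|%:R ^+ r)%R.

(* [('J * r)%act] acts on an r-tuple by applying the conjugation action ['J]
   to every component. *)
Definition kappa (gT : finGroupType) (r : nat) (G : {set gT}) : nat :=
  #|[set orbit ('J * r)%act G x | x in Comm r G]|.

(* Main.v *)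
Require Import Defs.
From mathcomp Require Import all_boot all_order all_algebra.
From mathcomp Require Import all_fingroup all_solvable.
From mathcomp Require Import ring.

(** Commuting tuples are counted by peeling off the first entry: a commuting
    (r+1)-tuple of G is some x in G followed by a commuting r-tuple of its
    centralizer, so |Comm_(r+1)(G)| is the sum over x in G of |Comm_r(C_G(x))|
    (card_CommS).  An element a fixes a commuting r-tuple exactly when the tuple
    lies in C_G(a), so the Cauchy-Frobenius count of the orbits on Comm_r(G)
    produces the same sum: kappa_r(G) |G| = |Comm_(r+1)(G)| (kappa_card).

    Both probabilities then reduce to knowing centralizers.  As |G'| = p, an
    element g has at most p conjugates under any subgroup A, since
    they lie in the coset gG'; their number is a power of p, so it is 1 or p
    (index_cent1_der_prime).  Applied to A acting on its own elements, this
    evaluates |Comm_2(A)| for every subgroup A in terms of |A| and |Z(A)|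
    (card_Comm2).  For |Comm_3(G)| the subgroups that occur are G and the
    centralizers H of noncentral elements; H has index p, and applying the
    dichotomy to Z(H) acting on an element outside H gives |Z(H)| = p |Z(G)|
    (card_center_cent1).  The result depends only on p, |G| and |Z(G)|:
    p^3 |Comm_3(G)| = |G|^2 (|G| + (p^3 - 1) |Z(G)|)  (card_Comm3). *)

Set Implicit Arguments.
Unset Strict Implicit.
Unset Printing Implicit Defensive.

Import GRing.Theory.
Local Open Scope ring_scope.

Lemma CommP (gT : finGroupType) (r : nat) (G : {set gT}) (t : r.-tuple gT) :
  reflect ((forall i, tnth t i \in G) /\
           (forall i j, commute (tnth t i) (tnth t j)))
          (t \in Comm r G).
Proof.
rewrite inE; apply: (iffP andP) => -[tG tC]; split.
- exact/forallP.
- by move=> i j; apply/eqP; move/forallP/(_ i)/forallP/(_ j): tC.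
- exact/forallP.
- by apply/forallP => i; apply/forallP => j; apply/eqP/tC.
Qed.

Lemma Comm_cons (gT : finGroupType) (r : nat) (G : {group gT})
    (x : gT) (t : r.-tuple gT) :
  ([tuple of x :: t] \in Comm r.+1 G)
    = (x \in G) && (t \in Comm r ('C_G[x])%g).
Proof.
apply/CommP/andP => [[xtG xtC]|[xG /CommP[tG tC]]].
  split; first by have := xtG ord0; rewrite tnth0.
  apply/CommP; split=> [i|i j].
    have := xtG (lift ord0 i); have := xtC ord0 (lift ord0 i).
    rewrite tnth0 tnthS => xi iG; rewrite inE iG; exact/cent1P/commute_sym.
  by have := xtC (lift ord0 i) (lift ord0 j); rewrite !tnthS.
have tx i : commute x (tnth t i).
  by have /setIP[_ /cent1P] := tG i; exact: commute_sym.
split=> [i|i j].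
  case: (unliftP ord0 i) => [k|] ->; rewrite ?tnth0 ?tnthS //.
  by have /setIP[] := tG k.
case: (unliftP ord0 i) => [k|] ->; case: (unliftP ord0 j) => [l|] ->;
  rewrite ?tnth0 ?tnthS //; exact: commute_sym.
Qed.

(** Group the tuples by their first entry x: the rest commutes with x and
    with itself, which is exactly a commuting tuple of the centralizer. *)
Lemma card_CommS (gT : finGroupType) (r : nat) (G : {group gT}) :
  #|Comm r.+1 G| = (\sum_(x in G) #|Comm r ('C_G[x])%g|)%N.
Proof.
rewrite -sum1_card (partition_big (@thead _ _) [in G]) /=; last first.
  by move=> t; rewrite (tuple_eta t) Comm_cons theadE => /andP[].
apply: eq_bigr => x xG; rewrite -sum1_card.
rewrite (reindex_onto (fun t : r.-tuple gT => cons_tuple x t)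
           (fun t : r.+1.-tuple gT => behead_tuple t)) /=; last first.
  by move=> t /andP[_ /eqP <-]; apply: val_inj; rewrite [in RHS](tuple_eta t).
apply: eq_bigl => t; rewrite (Comm_cons G x t) xG.
have -> : behead_tuple (cons_tuple x t) = t by apply: val_inj.
by rewrite [thead _]theadE !eqxx !andbT.
Qed.

Lemma card_Comm1 (gT : finGroupType) (G : {group gT}) : #|Comm 1 G| = #|G|.
Proof.
rewrite card_CommS -sum1_card; apply: eq_bigr => x _.
apply/eqP/cards1P; exists [tuple]; apply/setP => t.
by rewrite (tuple0 t) inE eqxx; apply/CommP; split=> [[]|[]].
Qed.

(** Fixing a tuple under simultaneous conjugation means commuting with each
    entry; this is what turns fixed points into the terms of card_CommS. *)
Lemma Fix_Comm (gT : finGroupType) (r : nat) (G : {group gT}) (a : gT) :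
  'Fix_(Comm r G | ('J * r)%act)[a]%g = Comm r ('C_G[a])%g.
Proof.
apply/setP => t; rewrite inE.
have -> : (t \in afix ('J * r)%act [set a]) = [forall i, tnth t i \in 'C[a]%g].
  apply/afix1P/forallP => [ta i | ta].
    move/(congr1 (fun u => tnth u i)): ta; rewrite tnth_map /= => /conjg_fixP.
    by move/commgP => ta; apply/cent1P.
  apply: eq_from_tnth => i; rewrite tnth_map /=.
  by apply/conjg_fixP/commgP; exact/cent1P.
apply/andP/CommP => [[/CommP[tG tC] /forallP ta]|[tGa tC]].
  by split=> // i; rewrite inE tG ta.
by split; [apply/CommP; split=> // i | apply/forallP => i];
  have /setIP[] := tGa i.
Qed.

(** The Cauchy-Frobenius orbit count has the summands |Comm_r(C_G(a))|, the
    same as those of the recursion for |Comm_(r+1)(G)|. *)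
Lemma kappa_card (gT : finGroupType) (r : nat) (G : {group gT}) :
  (kappa r G * #|G|)%N = #|Comm r.+1 G|.
Proof.
rewrite card_CommS.
transitivity (\sum_(a in G) #|'Fix_(Comm r G | ('J * r)%act)[a]%g|)%N; last first.
  by apply: eq_bigr => a _; rewrite Fix_Comm.
rewrite Frobenius_Cauchy //; apply/subsetP => a aG; rewrite !inE.
apply/subsetP => t /CommP[tG tC]; rewrite inE; apply/CommP; split=> [i|i j].
  by rewrite tnth_map /= memJ_norm // (subsetP (normG G)).
by rewrite !tnth_map /= /commute -!conjMg tC.
Qed.

Lemma in_center_cent1 (gT : finGroupType) (A : {group gT}) (x : gT) :
  x \in A -> (x \in 'Z(A)%g) = (A \subset 'C[x]%g).
Proof. by move=> xA; rewrite inE xA -sub_cent1. Qed.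

(** The index counts the A-conjugates of g.  They all lie in gG', so there are
    at most p of them; the index is also a power of p, and it exceeds 1. *)
Lemma index_cent1_der_prime (gT : finGroupType) (G A : {group gT}) (p : nat)
    (g : gT) :
  prime p -> (p.-group G)%g -> #|G^`(1)%g| = p -> A \subset G -> g \in G ->
  ~~ (A \subset 'C[g]%g) -> #|A : 'C_A[g]|%g = p.
Proof.
move=> p_pr pG card_der sAG gG nCA.
have le_p : (#|A : 'C_A[g]|%g <= p)%N.
  rewrite index_cent1 -card_der -(card_lcoset _ g); apply: subset_leq_card.
  apply/subsetP=> _ /imsetP[a aA ->].
  rewrite mem_lcoset -/(commg g a); exact/mem_commg/(subsetP sAG).
have gt1 : (1 < #|A : 'C_A[g]|%g)%N.
  by rewrite indexg_gt1 subsetI subxx.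
have /p_natP[k Ek] : (p.-nat #|A : 'C_A[g]|)%g.
  exact: pnat_dvd (dvdn_indexg _ _) (pgroupS sAG pG).
rewrite Ek in le_p gt1 *; case: k {Ek} le_p gt1 => [|k] le_p gt1.
  by rewrite expn0 in gt1.
by apply/eqP; rewrite eqn_leq le_p -{1}[p]expn1 leq_exp2l ?prime_gt1.
Qed.

(** An element of Z(A) contributes |A| to the sum of the |C_A(x)|, and any
    other element contributes |A| / p.  The statement is multiplied by p to
    stay within natural numbers, and covers proper subgroups A because the
    count of triples needs it for centralizers. *)
Lemma card_Comm2 (gT : finGroupType) (G A : {group gT}) (p : nat) :
  prime p -> (p.-group G)%g -> #|G^`(1)%g| = p -> A \subset G ->
  (p * #|Comm 2 A| = #|A| * (#|A| + p.-1 * #|'Z(A)%g|))%N.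
Proof.
move=> p_pr pG card_der sAG; rewrite card_CommS big_distrr /=.
have p_gt0 := prime_gt0 p_pr.
rewrite (big_setID 'Z(A)%g) /= (setIidPr (center_sub A)).
rewrite (eq_bigr (fun _ => p * #|A|))%N => [|x xZ]; last first.
  rewrite card_Comm1 /= (setIidPl _) // -in_center_cent1 //.
  exact: subsetP (center_sub A) x xZ.
rewrite [X in (_ + X)%N](eq_bigr (fun _ => #|A|)) => [|x /setDP[xA nxZ]]; last first.
  rewrite card_Comm1 /= -[in RHS](Lagrange (subsetIl A 'C[x]%g)) mulnC.
  congr (_ * _)%N; symmetry.
  rewrite (index_cent1_der_prime p_pr pG card_der) ?(subsetP sAG) //.
  by rewrite -in_center_cent1.
rewrite !sum_nat_const cardsD (setIidPr (center_sub A)).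
move: (subset_leq_card (center_sub A)) => /subnKC.
(* Writing |A| = |Z(A)| + d removes the truncated subtraction. *)
move: (#|A| - _)%N => d <-; rewrite -{1 2}(prednK p_gt0); ring.
Qed.

(** With H = C_G(x), pick g in G outside H.  Elements of Z(H) commuting with g
    centralize both g and the index-p subgroup H, hence all of G; so
    C_(Z(H))(g) = Z(G), and this has index p in Z(H) because x itself lies in
    Z(H) and does not commute with g. *)
Lemma card_center_cent1 (gT : finGroupType) (G : {group gT}) (p : nat)
    (x : gT) :
  prime p -> (p.-group G)%g -> #|G^`(1)%g| = p -> x \in G -> x \notin 'Z(G)%g ->
  #|'Z('C_G[x])%g| = (p * #|'Z(G)%g|)%N.
Proof.
move=> p_pr pG card_der xG nxZ; set H := ('C_G[x])%G.
have sHG : H \subset G by exact: subsetIl.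
have index_cent1 y : y \in G -> ~~ (G \subset 'C[y]%g) -> #|G : 'C_G[y]|%g = p.
  exact: index_cent1_der_prime.
have nGx : ~~ (G \subset 'C[x]%g).
  by rewrite -in_center_cent1.
have [g gG ngx] := subsetPn nGx.
have xH : x \in H by rewrite inE xG cent1id.
have xZH : x \in 'Z(H)%g.
  by rewrite inE xH -sub_cent1 subsetIr.
have sZHG : 'Z(H)%g \subset G := subset_trans (center_sub H) sHG.
have nZg : ~~ ('Z(H)%g \subset 'C[g]%g).
  by apply/negP => /subsetP/(_ x xZH); rewrite cent1C; apply/negP.
have <- : ('C_('Z(H))[g])%g = 'Z(G)%g.
  apply/eqP; rewrite eqEsubset; apply/andP; split; apply/subsetP => y.
    case/setIP=> yZH; rewrite cent1C => gy.
    have yG := subsetP sZHG _ yZH.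
    rewrite inE yG -sub_cent1; apply: contraR ngx => nGy.
    (* If y were not central, then C_G(y) would have the same index p as H
       while containing it, so it would equal H and exclude g. *)
    have sHy : H \subset 'C_G[y]%g.
      by rewrite subsetI sHG sub_cent1; case/setIP: yZH.
    have eqH : H :=: ('C_G[y])%g.
      apply/eqP; rewrite eqEcard sHy -(leq_pmul2r (prime_gt0 p_pr)).
      rewrite -{1}(index_cent1 y yG nGy) Lagrange ?subsetIl //.
      by rewrite -(index_cent1 x xG nGx) Lagrange ?leqnn.
    have: g \in H by rewrite eqH inE gG.
    by case/setIP.
  case/setIP=> yG /centP yC; apply/setIP; split; last exact/cent1P/yC.
  apply/setIP; split; last by apply/centP => h /(subsetP sHG); exact: yC.
  by apply/setIP; split; last exact/cent1P/yC.
rewrite -(Lagrange (subsetIl 'Z(H)%g 'C[g]%g)) mulnC; congr (_ * _)%N.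
exact: (index_cent1_der_prime p_pr pG card_der).
Qed.

(** Split the first entry x: a central x leaves the pairs of G, while a
    noncentral x leaves the pairs of a subgroup of order |G| / p whose center
    has order p |Z(G)|, so that card_Comm2 evaluates both cases. *)
Lemma card_Comm3 (gT : finGroupType) (G : {group gT}) (p : nat) :
  prime p -> (p.-group G)%g -> #|G^`(1)%g| = p ->
  (p ^ 3 * #|Comm 3 G| = #|G| ^ 2 * (#|G| + (p ^ 3).-1 * #|'Z(G)%g|))%N.
Proof.
move=> p_pr pG card_der; rewrite card_CommS big_distrr /=.
have p_gt0 := prime_gt0 p_pr.
rewrite (big_setID 'Z(G)%g) /= (setIidPr (center_sub G)).
have cardG2 := card_Comm2 p_pr pG card_der (subxx G).
rewrite (eq_bigr (fun _ => p ^ 2 * (#|G| * (#|G| + p.-1 * #|'Z(G)%g|))))%N;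
  last first.
  move=> x xZ; rewrite (setIidPl _) ?expnSr -?mulnA ?cardG2 //.
  by rewrite -in_center_cent1 // (subsetP (center_sub G)).
rewrite [X in (_ + X)%N](eq_bigr
  (fun _ => #|G| * (#|G| + p.-1 * p ^ 2 * #|'Z(G)%g|)))%N; last first.
  move=> x /setDP[xG nxZ].
  have cardC2 := card_Comm2 p_pr pG card_der (subsetIl G 'C[x]%g).
  have cardC : (p * #|'C_G[x]%g| = #|G|)%N.
    rewrite -[RHS](Lagrange (subsetIl G 'C[x]%g)) mulnC; congr (_ * _)%N.
    rewrite (index_cent1_der_prime p_pr pG card_der) //.
    by rewrite -in_center_cent1.
  rewrite expnSr -mulnA cardC2 (card_center_cent1 p_pr pG card_der) //.
  rewrite -cardC; ring.
rewrite !sum_nat_const cardsD (setIidPr (center_sub G)).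
move: (subset_leq_card (center_sub G)) => /subnKC.
move: (#|G| - _)%N => d <-.
(* p^3 - 1 = (p - 1)(1 + p + p^2) leaves p - 1 as the only predecessor. *)
rewrite predn_exp !big_ord_recr big_ord0 /=.
by case: p p_gt0 {p_pr pG card_der cardG2} => // q _; ring.
Qed.

Theorem corollary7p4 (gT : finGroupType) (G : {group gT}) (p n : nat)
    (p_pr : prime p) (pG : (p.-group G)%g)
    (card_der : #|G^`(1)%g| = p)
    (index_center : #|G : 'Z(G)|%g = (p ^ (2 * n))%N) :
  [/\ P 2 G = 1 / p%:R + (1 - 1 / p%:R) * p%:R ^- (2 * n),
      P 3 G = (p%:R ^+ (2 * n) + p%:R ^+ 3 - 1) / p%:R ^+ (2 * n + 3),
      (kappa 2 G)%:R = #|G|%:R ^+ 2 * P 3 G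
    & (kappa 2 G)%:R = #|G|%:R ^+ 2 *
        ((p%:R ^+ (2 * n) + p%:R ^+ 3 - 1) / p%:R ^+ (2 * n + 3)) :> rat].
Proof.
have p_gt0 := prime_gt0 p_pr.
have natr_neq0 m : (0 < m)%N -> m%:R != 0 :> rat.
  by rewrite Num.Theory.pnatr_eq0 lt0n.
have p_neq0 := natr_neq0 _ p_gt0.
have Z_neq0 := natr_neq0 _ (cardG_gt0 'Z(G)%G).
have G_neq0 := natr_neq0 _ (cardG_gt0 G).
have pn_neq0 : p%:R ^+ (2 * n) != 0 :> rat by rewrite expf_neq0.
have cardG : #|G|%:R = #|'Z(G)%g|%:R * p%:R ^+ (2 * n) :> rat.
  by rewrite -natrX -natrM -index_center Lagrange ?center_sub.
have predE m : (0 < m)%N -> (m.-1)%:R = m%:R - 1 :> rat.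
  by move=> m_gt0; rewrite -subn1 natrB.
have card2 : #|Comm 2 G|%:R = #|G|%:R * (#|G|%:R + (p%:R - 1) * #|'Z(G)%g|%:R)
    / p%:R :> rat.
  rewrite -predE // -natrM -natrD -natrM -(card_Comm2 p_pr pG) //.
  by rewrite natrM mulrC mulKf.
have card3 : #|Comm 3 G|%:R =
    #|G|%:R ^+ 2 * (#|G|%:R + (p%:R ^+ 3 - 1) * #|'Z(G)%g|%:R)
    / p%:R ^+ 3 :> rat.
  rewrite -!natrX -predE ?expn_gt0 ?p_gt0 // -natrM -natrD -natrM.
  rewrite -(card_Comm3 p_pr pG) //.
  by rewrite natrM mulrC mulKf // natrX expf_neq0.
have P3 : P 3 G = (p%:R ^+ (2 * n) + p%:R ^+ 3 - 1) / p%:R ^+ (2 * n + 3).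
  rewrite /P card3 cardG exprD; move: pn_neq0; set q := p%:R ^+ _ => q_neq0.
  by field; rewrite p_neq0 Z_neq0 q_neq0.
have kappa2 : (kappa 2 G)%:R = #|G|%:R ^+ 2 * P 3 G.
  by rewrite /P -kappa_card natrM; field; rewrite G_neq0.
split=> //; last by rewrite -P3.
rewrite /P card2 cardG; move: pn_neq0; set q := p%:R ^+ _ => q_neq0.
by field; rewrite p_neq0 Z_neq0 q_neq0.
Qed.
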